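(* Let $\omega$ be a real number with $\omega^2+\omega-1=0$. Let $k\ge1$ and let $H(k)$ be the half graph with color classes $\{u_1,\ldots,u_k\}$ and $\{v_1,\ldots,v_k\}$, where $u_i\sim v_j$ if and only if $j\le k-i+1$. Let $(b_1,\ldots,b_{10})=(\omega,-1,0,1,-\omega,-\omega,1,0,-1,\omega)$ and define $\mathbf{x}=(x_1,\ldots,x_k)$ by $x_i=b_s$ whenever $i\equiv s\pmod{10}$, $1\le s\le 10$. Let $\mathbf{y}$ be the vector on $V(H(k))$ with $\mathbf{y}(u_i)=\mathbf{y}(v_i)=x_i$ for $i=1,\ldots,k$. Then $\mathbf{y}$ is an eigenvector of the adjacency matrix of $H(k)$ for eigenvalue $\omega$ if $k\equiv 7\pmod{10}$, and it is an eigenvector for eigenvalue $-\omega$ if $k\equiv 2\pmod{10}$.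
   Context: Graphs are simple and undirected; the adjacency matrix $A(G)$ has $(i,j)$-entry $1$ if the $i$-th and $j$-th vertices are adjacent and $0$ otherwise. The half graph $H(k)$ is as defined in the claim. *)

(* Defs.v *)
From mathcomp Require Import all_boot all_order all_algebra.
From mathcomp Require Import reals.

Set Implicit Arguments.
Unset Strict Implicit.
Unset Printing Implicit Defensive.

Import Order.TTheory GRing.Theory Num.Theory.
Local Open Scope ring_scope.

Record sgraph (T : finType) := SGraph {
  adj :> rel T;
  adj_sym : symmetric adj;
  adj_irr : irreflexive adj }.

(* The vertices are ordered by the canonical enumeration of T. *)
Definition adjmx (R : pzSemiRingType) (T : finType) (G : sgraph T) : 'M[R]_#|T| :=
  \matrix_(i, j) (G (enum_val i) (enum_val j))%:R.

Definition vertex_vec (R : pzSemiRingType) (T : finType) (f : T -> R) : 'cV[R]_#|T| :=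
  \col_i f (enum_val i).

(* Column vectors; mxalgebra's eigenspace acts on row vectors instead. *)
Definition eigenvector (F : fieldType) (n : nat) (A : 'M[F]_n) (a : F)
    (v : 'cV[F]_n) : Prop :=
  v != 0 /\ A *m v = a *: v.

(* inl i is u_(i+1) and inr j is v_(j+1): 'I_k is 0-based, whereas the rule
   j <= k - i + 1 is for 1-based indices. *)
Definition half_adj (k : nat) : rel ('I_k + 'I_k)%type :=
  fun a b =>
    match a, b with
    | inl i, inr j | inr j, inl i => (j.+1 <= k - i.+1 + 1)%N
    | _, _ => false
    end.

Lemma half_adj_sym k : symmetric (@half_adj k).
Proof. by case=> i [] j. Qed.

Lemma half_adj_irr k : irreflexive (@half_adj k).
Proof. by case. Qed.

Definition half_graph (k : nat) : sgraph ('I_k + 'I_k)%type :=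
  SGraph (@half_adj_sym k) (@half_adj_irr k).

(* b_s is the entry of 0-based index s - 1. *)
Definition bvals (R : pzRingType) (w : R) : seq R :=
  [:: w; -1; 0; 1; - w; - w; 1; 0; -1; w].

(* x_i for a 1-based index i; see xcoefE. *)
Definition xcoef (R : pzRingType) (w : R) (i : nat) : R :=
  (bvals w)`_(i.-1 %% 10).

Lemma xcoefE (R : pzRingType) (w : R) (i s : nat) :
  (0 < i)%N -> (1 <= s <= 10)%N -> (i = s %[mod 10])%N ->
  xcoef w i = (bvals w)`_(s.-1).
Proof.
case: i => // i _; case: s => // s /= s10 /eqP.
rewrite -(addn1 i) -(addn1 s) eqn_modDr => /eqP is10.
by rewrite /xcoef addn1 succnK is10 modn_small.
Qed.

Definition yfun (R : pzRingType) (w : R) (k : nat) (a : 'I_k + 'I_k) : R :=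
  match a with inl i | inr i => xcoef w i.+1 end.

(* Main.v *)
(** Row [i] (0-based) of the half graph picks out the first [k - i] entries, so
    the eigenvector equation at [u_i] or [v_i] says that the [(k - i)]-th
    partial sum of [x] is [± w * x_i].  As the ten values [b_s] sum to zero, the
    partial sums are 10-periodic too, and for each of the two residues of [k]
    the equation reduces to ten identities in [w], all consequences of
    [w ^ 2 = 1 - w]. *)
Require Import Defs.
From mathcomp Require Import all_boot all_order all_algebra.
From mathcomp Require Import reals ring zify.

Import Order.TTheory GRing.Theory Num.Theory.
Local Open Scope ring_scope.

Definition partial_sums {R : pzRingType} (w : R) : seq R :=
  [:: 0; w; w - 1; w - 1; w; 0; - w; 1 - w; 1 - w; - w].

Lemma sum_xcoef (R : comPzRingType) (w : R) (n : nat) :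
  \sum_(j < n) xcoef w j.+1 = (partial_sums w)`_(n %% 10).
Proof.
elim: n => [|n IHn]; first by rewrite big_ord0.
rewrite big_ord_recr /= IHn /xcoef /= -[n.+1]addn1 -modnDml.
have : (n %% 10 < 10)%N by rewrite ltn_mod.
(* At residue 9 the list wraps around to its entry 0, since [- w] plus the last value [w]
   vanishes. *)
by case: (n %% 10)%N; do 10?[case] => //= *; ring.
Qed.

Lemma mulmx_adjmx (R : pzSemiRingType) (T : finType) (G : sgraph T)
    (f : T -> R) (a : 'I_#|T|) :
  (adjmx R G *m vertex_vec f) a 0 = \sum_(t | G (enum_val a) t) f t.
Proof.
rewrite mxE (reindex_onto (@enum_rank T) enum_val) => [|j _]; last first.
  exact: enum_valK.
rewrite [RHS]big_mkcond; apply: eq_big => [t|t _]; first by rewrite enum_rankK eqxx.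
by rewrite !mxE enum_rankK; case: (G _ t); rewrite ?mul1r ?mul0r.
Qed.

Lemma sum_half_graph (R : comPzRingType) (w : R) (k : nat) (a : 'I_k + 'I_k) :
  let i := match a with inl i | inr i => i end in
  \sum_(t | half_graph k a t) yfun w t = (partial_sums w)`_((k - i) %% 10).
Proof.
move=> i; rewrite -sum_xcoef (big_ord_widen k (fun j => xcoef w j.+1)) ?leq_subr //.
(* Natural subtraction truncates; the bounds agree because [i < k]. *)
have ltE (j : 'I_k) : (j.+1 <= k - i.+1 + 1)%N = (j < k - i)%N.
  by have := ltn_ord i; lia.
case: a @i ltE => i /= ltE; rewrite big_sumType /=.
  by rewrite big_pred0_eq add0r; apply: eq_bigl => j; rewrite ltE.
rewrite big_pred0_eq addr0; apply: eq_bigl => j.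
(* From the [v] side adjacency has [i] and [j] exchanged, so [ltE] does not apply as it stands; both
   conditions amount to [i + j < k]. *)
by have := ltn_ord i; have := ltn_ord j; lia.
Qed.

Lemma eigenvector_half_graph (F : fieldType) (w l : F) (k : nat) :
    (0 < k)%N -> w != 0 ->
    (forall i, (i < k)%N -> (partial_sums w)`_((k - i) %% 10) = l * xcoef w i.+1) ->
  eigenvector (adjmx F (half_graph k)) l (vertex_vec (@yfun F w k)).
Proof.
move=> k_gt0 w_neq0 eq_l; split.
  (* The entry at the first [u] vertex is [w] itself. *)
  apply: contraNneq w_neq0 => /matrixP/(_ (enum_rank (inl (Ordinal k_gt0))) 0).
  by rewrite !mxE enum_rankK => /= <-.
apply/colP => a; rewrite mulmx_adjmx sum_half_graph !mxE.
by case: (enum_val a) => i; rewrite eq_l.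
Qed.

Theorem theorem3p5 (R : realType) (w : R) (hw : w ^+ 2 + w - 1 = 0)
    (k : nat) (hk : (1 <= k)%N) :
  ((k = 7 %[mod 10])%N ->
     eigenvector (adjmx R (half_graph k)) w (vertex_vec (@yfun R w k))) /\
  ((k = 2 %[mod 10])%N ->
     eigenvector (adjmx R (half_graph k)) (- w) (vertex_vec (@yfun R w k))).
Proof.
have w_neq0 : w != 0.
  apply: contra_eq_neq hw => ->.
  by rewrite expr0n addr0 sub0r oppr_eq0 oner_eq0.
have w2 : w * w = 1 - w by apply/eqP; rewrite -subr_eq0 -[X in _ == X]hw; apply/eqP; ring.
split=> kmod; apply: eigenvector_half_graph => // i lt_ik; rewrite /xcoef /=.
(* [17] is the residue 7 raised by 10, so that subtracting [i %% 10], at most 9, never truncates;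
   [12] serves likewise for the residue 2. *)
- have -> : ((k - i) %% 10 = (17 - i %% 10) %% 10)%N by lia.
  have : (i %% 10 < 10)%N by rewrite ltn_mod.
  by case: (i %% 10)%N; do 10?[case] => //= *; ring: w2.
- have -> : ((k - i) %% 10 = (12 - i %% 10) %% 10)%N by lia.
  have : (i %% 10 < 10)%N by rewrite ltn_mod.
  by case: (i %% 10)%N; do 10?[case] => //= *; ring: w2.
Qed.
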